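(* If $G$ is a connected cubic graph of order $n$ that is isomorphic neither to $K_4$ nor to $K_{3,3}$, then $\gamma_{\rm gr}^{\rm Z}(G)\ge\frac{n}{2}$, and the bound is sharp (that is, there exists such a graph $G$, of some order $n$, with $\gamma_{\rm gr}^{\rm Z}(G)=\frac{n}{2}$).
   Context: Graphs are finite and simple; the order of a graph is its number of vertices; a cubic graph is a 3-regular graph. $N_G(v)$ is the set of neighbors of $v$ and $N_G[v]=N_G(v)\cup\{v\}$. For a graph $G$ with no isolated vertices, a sequence $(v_1,\ldots,v_m)$ of vertices of $G$ is a Z-sequence if it consists of distinct vertices and for every $i\in\{2,\ldots,m\}$, $N_G(v_i)\setminus\bigcup_{j=1}^{i-1}N_G[v_j]\neq\emptyset$. The Z-Grundy domination number $\gamma_{\rm gr}^{\rm Z}(G)$ is the maximum length of a Z-sequence in $G$. *)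

(* Defs.v *)
From mathcomp Require Import all_boot.

Set Implicit Arguments.
Unset Strict Implicit.
Unset Printing Implicit Defensive.

Record sgraph := SGraph {
  vertex :> finType;
  adj : rel vertex;
  adj_sym : symmetric adj;
  adj_irrefl : irreflexive adj }.

Section Graph.
Variable G : sgraph.
Implicit Types u v : G.

Definition open_nbh v : {set G} := [set u | adj v u].
Definition closed_nbh v : {set G} := v |: open_nbh v.

Definition cubic : Prop := forall v, #|open_nbh v| = 3.

(* The null graph is not connected; without this convention it would be a
   degenerate example of a connected cubic graph. *)
Definition connected : Prop :=
  0 < #|G| /\ forall u v, connect (@adj G) u v.

(* Entries are numbered from 0, so the entries v_2, ..., v_m of the usual
   1-based numbering are those with 0 < i. *)
Definition Z_sequence m (t : m.-tuple G) : bool :=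
  uniq t &&
  [forall i : 'I_m, (0 < i) ==>
     (open_nbh (tnth t i) :\: \bigcup_(j < m | j < i) closed_nbh (tnth t j)
        != set0)].

(* A Z-sequence has distinct entries, hence length at most #|G|: the bound on m
   excludes nothing. The number is only meaningful for graphs without isolated
   vertices. *)
Definition Z_Grundy : nat :=
  \max_(m < #|G|.+1 | [exists t : m.-tuple G, Z_sequence t]) m.

End Graph.

Definition isomorphic (G H : sgraph) : Prop :=
  exists2 f : G -> H, bijective f & forall u v, adj (f u) (f v) = adj u v.

Definition complete_adj n : rel 'I_n := fun i j => i != j.

Fact complete_sym n : symmetric (@complete_adj n).
Proof. by move=> i j; rewrite /complete_adj eq_sym. Qed.

Fact complete_irrefl n : irreflexive (@complete_adj n).
Proof. by move=> i; rewrite /complete_adj eqxx. Qed.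

Definition complete_graph n : sgraph :=
  SGraph (@complete_sym n) (@complete_irrefl n).

Definition bipartite_adj m n : rel ('I_m + 'I_n)%type := fun u v =>
  match u, v with
  | inl _, inr _ | inr _, inl _ => true
  | _, _ => false
  end.

Fact bipartite_sym m n : symmetric (@bipartite_adj m n).
Proof. by move=> [i|i] [j|j]. Qed.

Fact bipartite_irrefl m n : irreflexive (@bipartite_adj m n).
Proof. by move=> [i|i]. Qed.

Definition complete_bipartite m n : sgraph :=
  SGraph (@bipartite_sym m n) (@bipartite_irrefl m n).

(* Main.v *)
Require Import Defs.
From mathcomp Require Import all_boot all_order all_algebra.
From mathcomp Require Import zify.
Import Order.TTheory GRing.Theory Num.Theory.
Local Open Scope ring_scope.

Set Implicit Arguments.
Unset Strict Implicit.
Unset Printing Implicit Defensive.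

Local Open Scope nat_scope.

(** In a cubic graph the first entry of a Z-sequence dominates 4 vertices (it
    and its neighbours), and as long as some vertex is undominated, connectivity
    yields a dominated vertex [v] with an undominated neighbour.  Appending [v]
    is allowed, and dominates at most 2 new vertices, because [v] is adjacent to
    the entry that dominates it.  So a sequence extended greedily in this way
    dominates at most [2k + 2] vertices after [k] entries, which only gives
    length [n/2 - 1].

    One saving is enough.  If some Z-sequence with [k] entries dominates at most
    [2k + 1] vertices, then its greedy extension has length [m] with
    [n <= 2m + 1], and [n <= 2m] since a cubic graph has even order
    ([saving_half_order]).  Suppose therefore that no saving exists: appending a
    dominated vertex to a greedy sequence never dominates exactly one new vertex
    ([no_single_new]).  Then:
    - two adjacent vertices with a common neighbour have the same closed
      neighbourhood, so a triangle makes the graph [K4] ([triangle_complete]);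
    - without triangles, the last greedy step dominates two last vertices [p]
      and [q], and every neighbour of one is a neighbour of the other
      ([twins_exist]);
    - such twins force all neighbours of [p] to have the same neighbourhood,
      which makes the graph [K33] ([twins_bipartite]).

    For sharpness, each entry of a Z-sequence after the first dominates at least
    one new vertex, so the number is at most [n - 3]; the prism over a triangle
    has [n = 6], and both bounds give 3. *)

(** * Z-sequences built by prepending *)

Section Sequences.
Variable G : sgraph.
Implicit Types (a b c p q u v w x y : G) (s : seq G).

Definition dominated s : {set G} := \bigcup_(v in s) closed_nbh v.

(** Z-sequences listed with the newest vertex first, so that extending one is a
    [cons].  The condition is also imposed on the first chosen vertex, where it
    says that this vertex is not isolated.  Distinctness of the entries follows
    from the condition: see [legal_uniq]. *)
Fixpoint legal s : bool :=
  if s is v :: s' then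
    (open_nbh v :\: dominated s' != set0) && legal s'
  else true.

Lemma in_open u v : (u \in open_nbh v) = adj v u.
Proof. by rewrite inE. Qed.

Lemma in_closed u v : (u \in closed_nbh v) = (u == v) || adj v u.
Proof. by rewrite !inE. Qed.

Lemma adjC u v : adj u v = adj v u. Proof. exact: adj_sym. Qed.

Lemma dominatedP s x :
  reflect (exists2 v, v \in s & (x == v) || adj v x) (x \in dominated s).
Proof.
by apply: (iffP bigcupP) => -[v sv]; [rewrite in_closed | rewrite -in_closed];
  exists v.
Qed.

Lemma dominated_nil : dominated [::] = set0.
Proof. by apply/setP=> x; rewrite inE; apply/dominatedP => -[]. Qed.

Lemma dominated_cons v s : dominated (v :: s) = closed_nbh v :|: dominated s.
Proof.
apply/setP=> x; rewrite in_setU in_closed.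
apply/dominatedP/orP => [[u]|[vx|/dominatedP[u su ux]]].
- rewrite inE => /predU1P[-> vx|su ux]; first by left.
  by right; apply/dominatedP; exists u.
- by exists v; rewrite ?mem_head.
- by exists u; rewrite // inE su orbT.
Qed.

Lemma dominated1 v : dominated [:: v] = closed_nbh v.
Proof. by rewrite dominated_cons dominated_nil setU0. Qed.

Lemma open_nbh_dominated s v : v \in s -> open_nbh v \subset dominated s.
Proof.
move=> sv; apply/subsetP=> x; rewrite in_open => vx.
by apply/dominatedP; exists v; rewrite // vx orbT.
Qed.

Lemma dominated_rev s : dominated (rev s) = dominated s.
Proof. by apply: eq_bigl => x; rewrite mem_rev. Qed.

(** A repeated vertex has all its neighbours dominated already. *)
Lemma legal_uniq s : legal s -> uniq s.
Proof.
elim: s => //= v s IH /andP[nv /IH ->]; rewrite andbT.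
by apply: contra nv => /open_nbh_dominated; rewrite setD_eq0.
Qed.

Lemma legal_revP s x0 :
  reflect (forall i, i < size s ->
             open_nbh (nth x0 s i) :\: dominated (take i s) != set0)
          (legal (rev s)).
Proof.
elim/last_ind: s => [|s v IH]; first by apply: ReflectT.
rewrite rev_rcons /= dominated_rev.
apply: (iffP andP) => [[nv /IH ls] i|H].
  rewrite size_rcons ltnS leq_eqVlt nth_rcons => /predU1P[->|lt_is].
    by rewrite ltnn eqxx -cats1 take_size_cat.
  by rewrite lt_is -cats1 takel_cat ?ls // ltnW.
split.
  have:= H (size s); rewrite size_rcons nth_rcons ltnn eqxx.
  by rewrite -cats1 take_size_cat //; apply.
apply/IH => i lt_is; have:= H i.
rewrite size_rcons nth_rcons lt_is -cats1 (takel_cat _ (ltnW lt_is)); apply.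
exact: leqW.
Qed.

Lemma dominated_take m (t : m.-tuple G) i : i <= m ->
  dominated (take i t) = \bigcup_(j < m | j < i) closed_nbh (tnth t j).
Proof.
move=> le_im; apply/setP=> x; apply/bigcupP/bigcupP => [[v]|[j lt_ji xj]].
  have x0 := v; case/(nthP x0)=> j; rewrite size_takel ?size_tuple // => lt_ji.
  rewrite nth_take // => <- xj; have lt_jm := leq_trans lt_ji le_im.
  by exists (Ordinal lt_jm); rewrite // (tnth_nth x0).
exists (tnth t j) => //; rewrite (tnth_nth x) -(nth_take x lt_ji).
by rewrite mem_nth // size_takel ?size_tuple.
Qed.

(** With no isolated vertex, the extra condition that [legal] puts on the first
    chosen vertex is automatic. *)
Lemma Z_sequenceP m (t : m.-tuple G) :
  (forall v, open_nbh v != set0) -> Z_sequence t = legal (rev t).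
Proof.
move=> no_isolated; apply/andP/idP => [[_ /forallP Zt]|lt].
  case: m t Zt => [t _|m t Zt]; first by rewrite (tuple0 t).
  apply/(legal_revP t (thead t)) => i; rewrite size_tuple => lt_im.
  have:= Zt (Ordinal lt_im).
  rewrite -(dominated_take t (ltnW lt_im)) (tnth_nth (thead t)) /=.
  by case: i {lt_im} => //=; rewrite take0 dominated_nil setD0.
split; first by rewrite -rev_uniq; apply: legal_uniq.
apply/forallP=> i; apply/implyP=> _; have x0 := tnth t i.
rewrite -dominated_take ?(ltnW (ltn_ord i)) // (tnth_nth x0).
by move/legal_revP: lt; apply; rewrite size_tuple.
Qed.

Lemma legal_size_Z_Grundy s :
  (forall v, open_nbh v != set0) -> legal s -> size s <= Z_Grundy G.
Proof.
move=> no_isolated ls.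
have les : size s < #|G|.+1 by rewrite ltnS -(card_uniqP (legal_uniq ls)) max_card.
rewrite /Z_Grundy -[size s]/(nat_of_ord (Ordinal les)).
apply: (@leq_bigmax_cond _ _ (fun m : 'I_#|G|.+1 => m : nat) (Ordinal les)).
have sz : size (rev s) == size s by rewrite size_rev.
by apply/existsP; exists (Tuple sz); rewrite Z_sequenceP //= revK.
Qed.

End Sequences.

(** * Greedy extension in connected cubic graphs *)

Section Cubic.
Variable G : sgraph.
Hypotheses (conG : connected G) (cubG : cubic G).
Implicit Types (a b c p q u v w x y : G) (s : seq G).

Lemma cubic_no_isolated v : open_nbh v != set0.
Proof. by rewrite -card_gt0 cubG. Qed.

Lemma card_closed_nbh v : #|closed_nbh v| = 4.
Proof. by rewrite cardsU1 cubG in_open adj_irrefl. Qed.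

(** Handshake: [3 * #|G|] counts the ordered adjacent pairs, which come in pairs
    [(x, y)], [(y, x)] distinguished by the order of the ranks. *)
Lemma cubic_order_even : ~~ odd #|G|.
Proof.
pose r (x y : G) := enum_rank x < enum_rank y.
pose a (x y : G) : nat := adj x y && r x y.
have E : \sum_(x : G) \sum_(y : G) (adj x y : nat) =
    (\sum_(x : G) \sum_(y : G) a x y).*2.
  rewrite -addnn [X in _ = _ + X]exchange_big /= -big_split /=.
  apply: eq_bigr => x _; rewrite -big_split /=; apply: eq_bigr => y _.
  rewrite /a /r (adjC y x); have [->|neq_xy] := eqVneq x y.
    by rewrite adj_irrefl.
  case: ltngtP; case: (adj x y) => //= /ord_inj/enum_rank_inj eq_xy.
  by rewrite eq_xy eqxx in neq_xy.
have: \sum_(x : G) \sum_(y : G) (adj x y : nat) = 3 * #|G|.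
  rewrite mulnC -sum_nat_const; apply: eq_bigr => x _.
  rewrite -(cubG x) -sum1_card [RHS]big_mkcond /=; apply: eq_bigr => y _.
  by rewrite in_open; case: (adj x y).
by rewrite E => /(congr1 odd); rewrite odd_double oddM /= => <-.
Qed.

Lemma connected_closed_setT (A : {set G}) x : x \in A ->
  (forall u v, u \in A -> adj u v -> v \in A) -> A = [set: G].
Proof.
move=> Ax clA; apply/setP=> y; rewrite inE.
have clos : closed (@adj G) (mem A).
  apply: intro_closed => [|u v uv Au]; last exact: clA Au uv.
  by apply: sym_connect_sym; apply: adj_sym.
by rewrite -(closed_connect clos (proj2 conG x y)).
Qed.

Lemma not_dominated_neighbour s : s != [::] -> dominated s != setT ->
  exists2 v, v \in dominated s & open_nbh v :\: dominated s != set0.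
Proof.
case: s => // x s _ ndT; apply/exists_inP; apply: contraR ndT => /exists_inPn nE.
have Ax : x \in dominated (x :: s) by rewrite dominated_cons !inE eqxx.
apply/eqP/(connected_closed_setT Ax) => u v Au uv.
by move/nE: Au; rewrite negbK setD_eq0 => /subsetP; apply; rewrite in_open.
Qed.

Lemma card_dominated_cons s v : v \in dominated s ->
  #|dominated (v :: s)| = #|dominated s| + #|open_nbh v :\: dominated s|.
Proof.
move=> dv; rewrite -(cardsID (dominated s)); congr (_ + _).
  by congr #|pred_of_set _|; apply/setIidPr; rewrite dominated_cons subsetUr.
rewrite dominated_cons setDUl setDv setU0.
congr #|pred_of_set _|; apply/setP=> x; rewrite !inE.
by case: eqVneq => // ->; rewrite dv.
Qed.

(** The vertex of [s] that dominates [v] is either [v] itself, and then nothing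
    is new, or a neighbour of [v] that is already dominated. *)
Lemma card_new_le2 s v : v \in dominated s -> #|open_nbh v :\: dominated s| <= 2.
Proof.
case/dominatedP=> u su /predU1P[->|uv].
  by move: (open_nbh_dominated su); rewrite -setD_eq0 => /eqP->; rewrite cards0.
rewrite -ltnS -(cubG v); apply/proper_card/properP; split; first exact: subsetDl.
have du : u \in dominated s by apply/dominatedP; exists u; rewrite ?eqxx.
by exists u; rewrite ?inE ?du // adjC.
Qed.

(** Each greedy step adds 1 to the size and at most 2 to the number of dominated
    vertices, so the budget [2 * size s + k] is kept.  The final step is kept
    apart because the vertices that it dominates are the twins of
    [twins_exist]. *)
Lemma legal_last_step s k :
  legal s -> s != [::] -> dominated s != setT -> #|dominated s| <= 2 * size s + k ->
  exists s' v, [/\ legal (v :: s'), s' != [::], v \in dominated s',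
    dominated (v :: s') = setT & #|dominated s'| <= 2 * size s' + k].
Proof.
have [n] := ubnP #|~: dominated s|; elim: n s => // n IH s len ls s0 sT les.
have [v dv new] := not_dominated_neighbour s0 sT.
have lvs : legal (v :: s) by rewrite /= new.
have [vsT|vsT] := eqVneq (dominated (v :: s)) setT; first by exists s, v.
have new0 : 0 < #|open_nbh v :\: dominated s| by rewrite card_gt0.
have cvs := card_dominated_cons dv.
apply: (IH (v :: s)) => //.
- have := cardsC (dominated s); have := cardsC (dominated (v :: s)); lia.
- have := card_new_le2 dv; rewrite /=; lia.
Qed.

(** The odd bound [#|G| <= 2 * size + 1] reached by greedy extension improves by
    one because [#|G|] is even. *)
Lemma saving_half_order s : legal s -> s != [::] ->
  #|dominated s| <= 2 * size s + 1 -> #|G| <= 2 * Z_Grundy G.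
Proof.
move=> ls s0 les.
have [s' ls' les'] : exists2 s' : seq G, legal s' & #|G| <= 2 * size s' + 1.
  have [sT|sT] := eqVneq (dominated s) setT.
    by exists s; rewrite // -cardsT -sT.
  have [s' [v [lvs' _ dv vsT le1]]] := legal_last_step ls s0 sT les.
  exists (v :: s') => //; rewrite -cardsT -vsT card_dominated_cons //.
  have := card_new_le2 dv; rewrite /=; lia.
have := legal_size_Z_Grundy cubic_no_isolated ls'.
have := cubic_order_even; lia.
Qed.

Lemma legal1 v : legal [:: v].
Proof. by rewrite /= dominated_nil setD0 cubic_no_isolated. Qed.

(** * Graphs in which no step is saved *)

Section NoSaving.

Hypothesis no_saving : forall s,
  legal s -> s != [::] -> 2 * size s + 2 <= #|dominated s|.

(** A single new vertex would bring the number of dominated vertices to one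
    below the lower bound of [no_saving]. *)
Lemma no_single_new s v x : legal s -> s != [::] ->
  #|dominated s| <= 2 * size s + 2 -> v \in dominated s ->
  open_nbh v :\: dominated s \subset [set x] -> open_nbh v \subset dominated s.
Proof.
move=> ls s0 les dv /subset_leq_card; rewrite cards1 => new1.
rewrite -setD_eq0; apply: contraTT new1 => new.
have lvs : legal (v :: s) by rewrite /= new.
have := no_saving lvs isT; rewrite card_dominated_cons //=; lia.
Qed.

(** Only the third neighbour of [b] can lie outside the closed neighbourhood of
    [a], so it cannot be a new vertex for the sequence [a]. *)
Lemma triangle_closed_nbh a b c : adj a b -> adj a c -> adj b c ->
  closed_nbh b = closed_nbh a.
Proof.
move=> ab ac bc; apply/eqP; rewrite eqEcard !card_closed_nbh andbT.
have ba : b \in closed_nbh a by rewrite in_closed ab orbT.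
rewrite -dominated1 in ba *.
have [d Nb] : exists d, open_nbh b = [set a; c; d].
  have: #|open_nbh b :\: [set a; c]| == 1.
    rewrite cardsD (setIidPr _) ?cubG ?cards2.
      by have [ac'|//] := eqVneq a c; rewrite ac' adj_irrefl in ac.
    by apply/subsetP=> x /set2P[]->; rewrite in_open // adjC.
  case/cards1P=> d Nbd; exists d; rewrite -Nbd setDE setUIr setUCr setIT.
  by apply/esym/setUidPr/subsetP=> x /set2P[]->; rewrite in_open // adjC.
rewrite /closed_nbh subUset sub1set ba; apply: (@no_single_new _ _ d) => //.
- exact: legal1.
- by rewrite dominated1 card_closed_nbh.
rewrite dominated1 Nb; apply/subsetP=> x; rewrite !inE.
by case: (x == a) => //=; have [->|_] := eqVneq x c; rewrite ?ac //= => /andP[].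
Qed.

(** By [triangle_closed_nbh] all vertices of the closed neighbourhood of [a] have
    that same closed neighbourhood, which is then a component of 4 mutually
    adjacent vertices. *)
Lemma triangle_complete a b c : adj a b -> adj a c -> adj b c ->
  isomorphic G (complete_graph 4).
Proof.
move=> ab ac bc.
have NN u : u \in closed_nbh a -> closed_nbh u = closed_nbh a.
  rewrite in_closed => /predU1P[-> //|au].
  have [->|ub] := eqVneq u b; first exact: triangle_closed_nbh ab ac bc.
  apply: (triangle_closed_nbh au ab).
  have: u \in closed_nbh b by rewrite (triangle_closed_nbh ab ac bc) in_closed au orbT.
  by rewrite in_closed (negPf ub) adjC.
have aT : closed_nbh a = setT.
  apply: (@connected_closed_setT _ a) => [|u v /NN <- uv].
    by rewrite in_closed eqxx.
  by rewrite in_closed uv orbT.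
have cG : #|G| = 4 by rewrite -cardsT -aT card_closed_nbh.
exists (fun u => cast_ord cG (enum_rank u)).
  apply: (Bijective (g := fun i => enum_val (cast_ord (esym cG) i))) => u.
    by rewrite cast_ordK enum_rankK.
  by rewrite enum_valK cast_ordKV.
move=> u v /=; rewrite /complete_adj (inj_eq (@cast_ord_inj _ _ _)) (inj_eq enum_rank_inj).
have: v \in closed_nbh u by rewrite NN aT inE.
by rewrite in_closed eq_sym; case: eqVneq => //= ->; rewrite adj_irrefl.
Qed.

(** * Triangle-free graphs without savings *)

Section TriangleFree.

Hypothesis triangle_free : forall a b c, adj a b -> adj a c -> ~~ adj b c.

(** Before the last greedy step, the undominated set [D] consists of exactly two
    vertices [p] and [q].  A dominated vertex adjacent to one of them but not to the other
    would have a single new neighbour; and [p], [q] are not adjacent, as a second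
    neighbour of [p] would close a triangle. *)
Lemma twins_exist : exists p q, p != q /\ open_nbh p = open_nbh q.
Proof.
have [/card_gt0P[a _] _] := conG.
have aT : dominated [:: a] != setT.
  apply: contraTneq isT => aT.
  have /set0Pn[b] := cubic_no_isolated a; rewrite in_open => ab.
  have /card_gt0P[c] : 0 < #|open_nbh b :\ a|.
    by have := cardsD1 a (open_nbh b); rewrite cubG in_open adjC ab /=; lia.
  rewrite !inE => /andP[ca bc]; have: c \in dominated [:: a] by rewrite aT inE.
  rewrite dominated1 in_closed (negPf ca) /= => ac.
  by have := triangle_free ab ac; rewrite bc.
have a2 : #|dominated [:: a]| <= 2 * size [:: a] + 2 by rewrite dominated1 card_closed_nbh.
have [s [v [lvs s0 dv vsT les]]] := legal_last_step (legal1 a) isT aT a2.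
have ls : legal s by case/andP: lvs.
pose D := ~: dominated s.
have DE : open_nbh v :\: dominated s = D.
  rewrite setDE; apply/setIidPr/subsetP=> x; rewrite inE => xs.
  have: x \in dominated (v :: s) by rewrite vsT inE.
  rewrite dominated_cons inE (negPf xs) orbF in_closed => /predU1P[xv|].
    by rewrite xv dv in xs.
  by rewrite in_open.
have all_or_none x y z : x \in dominated s -> y \in D -> z \in D -> adj x y -> adj x z.
  move=> dx Dy Dz xy; have [->//|zy] := eqVneq z y.
  apply: contraTT (Dy) => xz; rewrite inE negbK.
  have D2 : [set y; z] = D.
    apply/eqP; rewrite eqEcard cards2 eq_sym zy -DE card_new_le2 // andbT DE.
    by apply/subsetP=> t /set2P[]->.
  have /subsetP : open_nbh x \subset dominated s.
    apply: (@no_single_new _ _ y ls s0 les dx).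
    apply/subsetP=> t; rewrite !inE => /andP[Dt xt].
    have: t \in [set y; z] by rewrite D2 inE.
    case/set2P=> [->//|tz].
    by rewrite tz (negPf xz) in xt.
  by apply; rewrite in_open.
have /cards2P[p [q [pq Dpq]]] : #|D| == 2.
  rewrite -DE eqn_leq card_new_le2 //.
  by have := no_saving lvs isT; rewrite card_dominated_cons //=; lia.
exists p, q; split=> //.
have [Dp Dq] : p \in D /\ q \in D by rewrite Dpq !inE !eqxx orbT.
have sub x : adj p x -> x \in dominated s -> adj q x.
  by move=> px dx; rewrite adjC; apply: all_or_none Dp Dq _; rewrite // adjC.
have npq : ~~ adj p q.
  apply/negP=> apq.
  have /card_gt0P[x] : 0 < #|open_nbh p :\ q|.
    by have := cardsD1 q (open_nbh p); rewrite cubG in_open apq /=; lia.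
  rewrite !inE => /andP[xq px].
  have dx : x \in dominated s.
    have: x \notin D; last by rewrite inE negbK.
    rewrite Dpq !inE negb_or xq andbT.
    by apply: contraTneq px => ->; rewrite adj_irrefl.
  by have := triangle_free apq px; rewrite (sub x px dx).
apply/eqP; rewrite eqEcard !cubG andbT; apply/subsetP=> x; rewrite !in_open => px.
apply: (sub x px); have: x \notin D; last by rewrite inE negbK.
rewrite Dpq !inE negb_or; apply/andP; split.
  by apply: contraTneq px => ->; rewrite adj_irrefl.
by apply: contraTneq px => ->.
Qed.

(** [A] and [B] are disjoint since no vertex is its own neighbour, and their
    union is closed under adjacency. *)
Lemma two_neighbourhoods_bipartite (A B : {set G}) a b :
  a \in A -> b \in B ->
  (forall x, x \in A -> open_nbh x = B) -> (forall x, x \in B -> open_nbh x = A) ->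
  isomorphic G (complete_bipartite 3 3).
Proof.
move=> Aa Bb NA NB.
have [cA cB] : #|A| = 3 /\ #|B| = 3 by rewrite -(NA a Aa) -(NB b Bb) !cubG.
have AB x : x \in A -> x \in B -> False.
  move=> Ax Bx; have: A = B by rewrite -(NB x Bx) NA.
  by move=> eqAB; have := adj_irrefl x; rewrite -in_open NA // Bx.
have ABT : A :|: B = setT.
  apply: (@connected_closed_setT _ a) => [|u v]; first by rewrite inE Aa.
  by rewrite !inE -in_open => /orP[/NA|/NB]->->; rewrite ?orbT.
have notA x : x \notin A -> x \in B.
  by move=> nAx; have := in_setT x; rewrite -ABT inE (negPf nAx).
pose f u : complete_bipartite 3 3 :=
  if u \in A then inl (inord (index u (enum A))) else inr (inord (index u (enum B))).
have index_inj (S : {set G}) x y : #|S| = 3 -> x \in S -> y \in S ->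
    inord (index x (enum S)) = inord (index y (enum S)) :> 'I_3 -> x = y.
  move=> cS Sx Sy /(congr1 val) /=.
  have lt3 z : z \in S -> index z (enum S) < 3.
    by move=> Sz; rewrite -cS cardE index_mem mem_enum.
  rewrite !inordK ?lt3 // => /(congr1 (nth x (enum S))).
  by rewrite !nth_index ?mem_enum.
exists f.
  apply: inj_card_bij => [x y|].
    rewrite /f; have [Ax|/notA Bx] := boolP (x \in A);
      have [Ay|/notA By] := boolP (y \in A) => // -[]; exact: index_inj.
  rewrite card_sum !card_ord -cardsT -ABT cardsU cA cB.
  rewrite (_ : A :&: B = set0) ?cards0 //.
  by apply/setP=> x; rewrite !inE; apply/negP=> /andP[]; apply: AB.
move=> u v; rewrite -(in_open v u) /f.
have [Au|nAu] := boolP (u \in A).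
  by rewrite NA //; case: (boolP (v \in A)) => [Av|/notA -> //]; apply/esym/negP/AB.
by rewrite NB ?notA //; case: (v \in A).
Qed.

(** Let [u] be a neighbour of [p].  After choosing [p] and [u], the twins and the
    whole of [N(p)] are dominated, so another [w] in [N(p)] has at most one
    undominated neighbour, hence none.  Without triangles its neighbours are not
    in [N(p)], so they are in [N(u)].  Thus [N(p)] and [N(u)] are the two sides
    of a complete bipartite graph. *)
Lemma twins_bipartite p q : p != q -> open_nbh p = open_nbh q ->
  isomorphic G (complete_bipartite 3 3).
Proof.
move=> pq Npq; have /set0Pn[u] := cubic_no_isolated p; rewrite in_open => pu.
have adjq x : adj q x = adj p x by rewrite -!in_open Npq.
have NA w : w \in open_nbh p -> open_nbh w = open_nbh u.
  rewrite in_open => pw.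
  have npq : ~~ adj p q by rewrite -adjq adj_irrefl.
  have du : u \in dominated [:: p] by rewrite dominated1 in_closed pu orbT.
  have new : open_nbh u :\: dominated [:: p] != set0.
    apply/set0Pn; exists q.
    by rewrite in_setD dominated1 in_closed in_open negb_or eq_sym pq npq adjC adjq.
  have lup : legal [:: u; p] by apply/andP; split=> //; apply: legal1.
  have two : #|dominated [:: u; p]| <= 2 * size [:: u; p] + 2.
    rewrite card_dominated_cons // dominated1 card_closed_nbh.
    by have := card_new_le2 du; rewrite dominated1 /=; lia.
  apply/eqP; rewrite eqEcard !cubG andbT.
  have dw : w \in dominated [:: u; p].
    by rewrite dominated_cons dominated1 !inE pw !orbT.
  have dq : q \in dominated [:: u; p].
    by rewrite dominated_cons !inE adjC adjq pu orbT.
  have dp : p \in dominated [:: u; p].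
    by rewrite dominated_cons dominated1 !inE eqxx !orbT.
  (* The neighbours [p] and [q] of [w] are dominated: only its third can be new. *)
  have [x wx] : exists x, open_nbh w :\: [set p; q] = [set x].
    apply/cards1P; rewrite cardsD (setIidPr _) ?cubG ?cards2 ?pq //.
    by apply/subsetP=> y /set2P[]->; rewrite in_open adjC ?adjq.
  have /subsetP sub : open_nbh w \subset dominated [:: u; p].
    apply: (no_single_new (x := x)) => //; rewrite -wx.
    apply/subsetP=> y; rewrite !in_setD => /andP[dy ->]; rewrite andbT.
    by apply: contra dy => /set2P[]->.
  apply/subsetP=> y wy; have := sub y wy; move: wy.
  rewrite dominated_cons dominated1 !inE => wy /orP[/predU1P[yu|//]|/predU1P[->|py]].
  - by have := triangle_free pw pu; rewrite -yu wy.
  - by rewrite adjC.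
  - by have := triangle_free pw py; rewrite wy.
have pin : p \in open_nbh u by rewrite in_open adjC.
apply: (@two_neighbourhoods_bipartite (open_nbh p) (open_nbh u) u p) => //.
  by rewrite in_open.
move=> x ux; apply/esym/eqP; rewrite eqEcard !cubG andbT.
by apply/subsetP=> w /NA Nw; rewrite in_open adjC -in_open Nw.
Qed.

End TriangleFree.

End NoSaving.

(** * Bounds on the Z-Grundy domination number *)

Theorem cubic_Z_Grundy_ge_half :
  ~ isomorphic G (complete_graph 4) ->
  ~ isomorphic G (complete_bipartite 3 3) -> #|G| <= 2 * Z_Grundy G.
Proof.
move=> nK4 nK33; rewrite leqNgt; apply/negP=> small.
have no_saving s : legal s -> s != [::] -> 2 * size s + 2 <= #|dominated s|.
  move=> ls s0; rewrite addnS ltnNge; apply/negP=> les.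
  by have := saving_half_order ls s0 les; rewrite leqNgt small.
have triangle_free a b c : adj a b -> adj a c -> ~~ adj b c.
  by move=> ab ac; apply/negP=> bc; apply: nK4; apply: triangle_complete ab ac bc.
have [p [q [pq Npq]]] := twins_exist no_saving triangle_free.
exact: nK33 (twins_bipartite no_saving triangle_free pq Npq).
Qed.

(** The first vertex dominates 4, and each later one at least one more. *)
Lemma legal_size_dominated s : legal s -> s != [::] -> size s + 3 <= #|dominated s|.
Proof.
elim: s => // v [|u s] IH /andP[new ls] _; first by rewrite dominated1 card_closed_nbh.
have: #|open_nbh v :\: dominated (u :: s)| + #|dominated (u :: s)| <=
      #|dominated (v :: u :: s)|.
  rewrite [dominated (v :: _)]dominated_cons.
  rewrite -[leqRHS](cardsID (dominated (u :: s))) [leqLHS]addnC setIUl setIid.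
  rewrite leq_add ?subset_leq_card ?subsetUr // setSD //.
  by rewrite /closed_nbh -setUA setUCA subsetUl.
by have := IH ls isT; rewrite -card_gt0 in new; rewrite /=; lia.
Qed.

Lemma cubic_Z_Grundy_le : Z_Grundy G + 3 <= #|G|.
Proof.
have [/card_gt0P[a _] _] := conG.
have G4 : 4 <= #|G| by rewrite -(card_closed_nbh a) max_card.
suff: Z_Grundy G <= #|G| - 3 by lia.
suff bound m (t : m.-tuple G) : Z_sequence t -> m <= #|G| - 3.
  by apply/bigmax_leqP=> m /existsP[t]; apply: bound.
rewrite Z_sequenceP; last exact: cubic_no_isolated.
have [m0|m_gt0] := posnP m; first by rewrite [leqLHS]m0.
move=> /legal_size_dominated; rewrite -size_eq0 !size_rev !size_tuple -lt0n.
by move=> /(_ m_gt0); have := max_card (dominated (rev t)); lia.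
Qed.

End Cubic.

(** * The prism *)

Definition prism_adj : rel (bool * 'I_3) := fun x y =>
  if x.1 == y.1 then x.2 != y.2 else x.2 == y.2.

Fact prism_sym : symmetric prism_adj.
Proof.
by move=> x y; rewrite /prism_adj [y.1 == _]eq_sym [y.2 == _]eq_sym.
Qed.

Fact prism_irrefl : irreflexive prism_adj.
Proof. by move=> x; rewrite /prism_adj !eqxx. Qed.

Definition prism : sgraph := SGraph prism_sym prism_irrefl.

Lemma card_prism : #|prism| = 6.
Proof. by rewrite card_prod card_bool card_ord. Qed.

Lemma prism_cubic : cubic prism.
Proof.
move=> [b i]; rewrite -sum1_card big_mkcond /=.
rewrite (eq_bigr (fun x : bool * 'I_3 => (prism_adj (b, i) (x.1, x.2) : nat))); last first.
  by move=> [c j] _; rewrite (in_open (G := prism) (c, j) (b, i)) /=; case: prism_adj.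
rewrite -(pair_bigA _ (fun c j => (prism_adj (b, i) (c, j) : nat))) big_bool /=.
rewrite !big_ord_recl !big_ord0 /prism_adj /=.
by case: b; case: i => [[|[|[|]]]].
Qed.

Lemma prism_connected : connected prism.
Proof.
split=> [|[b i] [c j]]; first by rewrite card_prism.
have inner (d : bool) : connect (@adj prism) (d, i) (d, j).
  have [->|ij] := eqVneq i j; first exact: connect0.
  by apply: connect1; rewrite /= /prism_adj /= eqxx.
apply: (connect_trans (inner b)); have [->|bc] := eqVneq b c; first exact: connect0.
by apply: connect1; rewrite /= /prism_adj /= (negPf bc).
Qed.

Lemma prism_not_K4 : ~ isomorphic prism (complete_graph 4).
Proof. by case=> f /bij_eq_card; rewrite card_prism card_ord. Qed.

(** The prism has triangles, and among three vertices of a bipartite graph two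
    are on the same side. *)
Lemma prism_not_K33 : ~ isomorphic prism (complete_bipartite 3 3).
Proof.
case=> f _ fE.
have := fE (true, inord 0) (true, inord 1); have := fE (true, inord 0) (true, inord 2).
have := fE (true, inord 1) (true, inord 2).
rewrite /= /prism_adj /= -!val_eqE /= !inordK //=.
by case: (f _) => ?; case: (f _) => ?; case: (f _) => ?.
Qed.

Local Close Scope nat_scope.

Theorem theorem3p4 :
  (forall G : sgraph,
     connected G -> cubic G ->
     ~ isomorphic G (complete_graph 4) ->
     ~ isomorphic G (complete_bipartite 3 3) ->
     #|G|%:R / 2 <= (Z_Grundy G)%:R :> rat)
  /\
  (exists G : sgraph,
     [/\ connected G, cubic G,
         ~ isomorphic G (complete_graph 4),
         ~ isomorphic G (complete_bipartite 3 3)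
       & (Z_Grundy G)%:R = #|G|%:R / 2 :> rat]).
Proof.
split=> [G conG cubG nK4 nK33|].
  rewrite ler_pdivrMr // -natrM ler_nat mulnC.
  exact: cubic_Z_Grundy_ge_half.
exists prism.
have lo := cubic_Z_Grundy_ge_half prism_connected prism_cubic
             prism_not_K4 prism_not_K33.
have up := cubic_Z_Grundy_le prism_connected prism_cubic.
split; [exact: prism_connected | exact: prism_cubic | exact: prism_not_K4
       | exact: prism_not_K33 |].
rewrite card_prism in lo up *.
by have -> : Z_Grundy prism = 3 by lia.
Qed.
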